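(* Let $\mathcal{A}=\{A_1,\ldots,A_m\}$ be a set of $m$ matrices in $\mathbb{R}^{n\times n}$ with joint spectral radius $\rho(\mathcal{A})$. Let $\hat\rho_{\mathcal{V}^2,G_1}(\mathcal{A})$ be the bound on the joint spectral radius obtained from the linear matrix inequalities $$P_i\succ0\quad \forall i\in\{1,\ldots,m\},\qquad \gamma^2A_i^TP_jA_i\preceq P_i\quad \forall (i,j)\in\{1,\ldots,m\}^2.$$ Then $$\frac{1}{\sqrt[4]{n}}\,\hat\rho_{\mathcal{V}^2,G_1}(\mathcal{A})\le\rho(\mathcal{A})\le\hat\rho_{\mathcal{V}^2,G_1}(\mathcal{A}).$$
   Context: The joint spectral radius is $\rho(\mathcal{A})=\lim_{k\to\infty}\max_{\sigma\in\{1,\ldots,m\}^k}\|A_{\sigma_k}\cdots A_{\sigma_1}\|^{1/k}$. The bound $\hat\rho_{\mathcal{V}^2,G_1}(\mathcal{A})$ is the reciprocal of the largest $\gamma$ for which the displayed inequalities are feasible in symmetric matrices $P_1,\ldots,P_m$; precisely, it is the infimum of $1/\gamma$ over all $\gamma>0$ for which they are feasible. $P\preceq Q$ means $Q-P$ is positive semidefinite. *)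

(* Defs.v *)
From HB Require Import structures.
From mathcomp Require Import all_boot all_order all_algebra.
From mathcomp Require Import all_classical all_reals all_analysis.

Set Implicit Arguments.
Unset Strict Implicit.
Unset Printing Implicit Defensive.

Import Order.TTheory GRing.Theory Num.Theory.
Import numFieldNormedType.Exports.

Local Open Scope classical_set_scope.
Local Open Scope ring_scope.

(* A predicate rather than the canonical norm of 'M_n, so that the joint
   spectral radius can be taken with respect to an arbitrary norm.
   Nonnegativity follows from the first two clauses. *)
Definition is_norm (R : realType) (V : lmodType R) (N : V -> R) : Prop :=
  [/\ forall x y : V, N (x + y) <= N x + N y,
      forall (a : R) (x : V), N (a *: x) = `|a| * N x
    & forall x : V, N x = 0 -> x = 0].

(* A_(s_k) *m ... *m A_(s_1): the first letter of s is the rightmost factor. *)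
Definition word_prod (R : realType) (m n : nat) (A : 'I_m -> 'M[R]_n)
    (s : seq 'I_m) : 'M[R]_n :=
  \big[mulmx/1%:M]_(i <- rev s) A i.

(* The maximum has default value 0, which is harmless because every term is
   nonnegative. The index k = 0 does not affect the limit. *)
Definition max_growth (R : realType) (m n : nat) (N : 'M[R]_n -> R)
    (A : 'I_m -> 'M[R]_n) (k : nat) : R :=
  \big[Num.max/0]_(s : k.-tuple 'I_m) (N (word_prod A s) `^ k%:R^-1).

Definition jsr (R : realType) (m n : nat) (N : 'M[R]_n -> R)
    (A : 'I_m -> 'M[R]_n) : R :=
  lim (max_growth N A k @[k --> \oo]).

Definition posdef (R : realType) (n : nat) (P : 'M[R]_n) : Prop :=
  P^T = P /\ forall x : 'cV[R]_n, x != 0 -> 0 < (x^T *m P *m x) 0 0.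

Definition possemidef (R : realType) (n : nat) (P : 'M[R]_n) : Prop :=
  P^T = P /\ forall x : 'cV[R]_n, 0 <= (x^T *m P *m x) 0 0.

Definition loewner_le (R : realType) (n : nat) (P Q : 'M[R]_n) : Prop :=
  possemidef (Q - P).

Definition lmi_feasible (R : realType) (m n : nat) (A : 'I_m -> 'M[R]_n)
    (gamma : R) : Prop :=
  exists P : 'I_m -> 'M[R]_n,
    (forall i, posdef (P i)) /\
    (forall i j, loewner_le (gamma ^+ 2 *: ((A i)^T *m P j *m A i)) (P i)).

(* The set is nonempty and bounded below by 0, so this is a genuine infimum. *)
Definition rho_hat (R : realType) (m n : nat) (A : 'I_m -> 'M[R]_n) : R :=
  inf [set gamma^-1 | gamma in [set g : R | 0 < g /\ lmi_feasible A g]].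

(* Main.v *)
Require Import Defs.
From mathcomp Require Import all_boot all_order perm all_algebra.
From mathcomp Require Import all_classical all_reals all_analysis.
From mathcomp Require Import ring lra.

(** Write [W_s] for the product of the matrices along a word [s], and call
    [r > 0] a growth rate if [W_s = O(r ^ |s|)].  In finite dimension all norms
    are equivalent and a constant factor disappears under k-th roots, so the
    joint spectral radius is the infimum of the growth rates, for every norm
    ([jsrE]).  Both inequalities then compare growth rates with feasible
    values of gamma.

    Upper bound.  Along a word, the inequalities multiply: the quadratic form
    of the last node at [W_s x] is at most [gamma ^ (- 2 |s|)] times the form of
    some node at [x].  Since positive definite forms dominate the coordinates,
    [gamma^-1] is a growth rate ([growth_rate_of_feasible]).

    Lower bound.  Let [r] be a growth rate.  The set [S] of the vectors
    [r ^ (- |s|) W_s^T e_j] is bounded, contains the basis, and is mapped into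
    [r S] by each [A_i^T]; so the norm [x |-> sup_(f in S) |f^T x|] grows by at
    most a factor [r] under each [A_i].  By Loewner's ellipsoid theorem, some
    quadratic form [Q] agrees with the square of this norm up to a factor
    [K > n] arbitrarily close to [n] ([loewner_ellipsoid]).  This loss [K] is
    independent of the matrix to which [Q] is applied, so it is paid only once
    for a product of two matrices: [Q (A_j A_i x) <= K r ^ 4 Q x].  With
    [l ^ 4 = K r ^ 4], the forms
      [P_i x = Q x + l ^ -2 Q (A_i x)]
    satisfy the inequalities for [gamma = l^-1], because the term
    [l ^ -2 Q (A_i x)] occurs on both sides and what remains is the bound on
    products of length two ([feasible_of_growth_rate]).  Hence the bound is at
    most [K ^ (1/4) r]: going from one matrix to two replaces the square root
    of the dimension by its fourth root. *)

Set Implicit Arguments.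
Unset Strict Implicit.
Unset Printing Implicit Defensive.

Import Order.TTheory GRing.Theory Num.Theory.
Import numFieldNormedType.Exports.

Local Open Scope classical_set_scope.
Local Open Scope ring_scope.

(** * Products along words *)

Lemma word_prod_rcons (R : realType) m n (A : 'I_m -> 'M[R]_n) s i :
  word_prod A (rcons s i) = A i *m word_prod A s.
Proof. by rewrite /word_prod rev_rcons big_cons. Qed.

Lemma word_prod_nil (R : realType) m n (A : 'I_m -> 'M[R]_n) :
  word_prod A [::] = 1%:M.
Proof. by rewrite /word_prod big_nil. Qed.

Lemma word_prod_cat (R : realType) m n (A : 'I_m -> 'M[R]_n) s t :
  word_prod A (s ++ t) = word_prod A t *m word_prod A s.
Proof.
elim/last_ind: t => [|t i IH]; first by rewrite cats0 word_prod_nil mul1mx.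
by rewrite -rcons_cat !word_prod_rcons IH mulmxA.
Qed.

Lemma word_prod_cons (R : realType) m n (A : 'I_m -> 'M[R]_n) i s :
  word_prod A (i :: s) = word_prod A s *m A i.
Proof.
by rewrite -cat1s word_prod_cat -[[:: i]]/(rcons [::] i) word_prod_rcons
  word_prod_nil mulmx1.
Qed.

(** * Equivalence of norms on matrices *)

(** The reference norm: the entrywise sum is submultiplicative without a
    dimensional constant, also for rectangular matrices. *)
Definition l1norm (R : realType) m n (A : 'M[R]_(m, n)) : R :=
  \sum_i \sum_j `|A i j|.

Lemma l1norm_ge0 (R : realType) m n (A : 'M[R]_(m, n)) : 0 <= l1norm A.
Proof. by apply: sumr_ge0 => i _; apply: sumr_ge0. Qed.

Lemma entry_le_l1norm (R : realType) m n (A : 'M[R]_(m, n)) i j :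
  `|A i j| <= l1norm A.
Proof.
rewrite /l1norm (bigD1 i) //= (bigD1 j) //= -addrA lerDl addr_ge0 //.
  exact: sumr_ge0.
by apply: sumr_ge0 => ? _; apply: sumr_ge0.
Qed.

Lemma l1norm_mulmx (R : realType) m n p (A : 'M[R]_(m, n)) (B : 'M[R]_(n, p)) :
  l1norm (A *m B) <= l1norm A * l1norm B.
Proof.
rewrite /l1norm mulr_suml; apply: ler_sum => i _.
have row_le k : \sum_j `|B k j| <= l1norm B.
  rewrite /l1norm [leRHS](bigD1 k) //= lerDl.
  by apply: sumr_ge0 => ? _; apply: sumr_ge0.
apply: (@le_trans _ _ (\sum_j \sum_k `|A i k| * `|B k j|)).
  apply: ler_sum => j _; rewrite mxE; apply: le_trans (ler_norm_sum _ _ _) _.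
  by apply: ler_sum => k _; rewrite normrM.
rewrite exchange_big mulr_suml; apply: ler_sum => k _ /=.
by rewrite -mulr_sumr ler_wpM2l.
Qed.

Lemma is_norm0 (R : realType) (V : lmodType R) (N : V -> R) :
  is_norm N -> N 0 = 0.
Proof. by case=> _ NZ _; rewrite -(scale0r (0 : V)) NZ normr0 mul0r. Qed.

Lemma is_norm_sum (R : realType) (V : lmodType R) (N : V -> R) I (r : seq I)
    (F : I -> V) : is_norm N -> N (\sum_(i <- r) F i) <= \sum_(i <- r) N (F i).
Proof.
move=> hN; elim: r => [|i r IH]; first by rewrite !big_nil is_norm0.
rewrite !big_cons; case: (hN) => ND _ _.
by apply: le_trans (ND _ _) _; rewrite lerD2l.
Qed.

Lemma is_norm_ge0 (R : realType) (V : lmodType R) (N : V -> R) x :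
  is_norm N -> 0 <= N x.
Proof.
move=> hN; have [ND NZ _] := hN.
have := ND x ((-1) *: x); rewrite NZ normrN1 mul1r scaleN1r subrr is_norm0 //.
by lra.
Qed.

Lemma norm_le_l1norm (R : realType) m n (N : 'M[R]_(m, n) -> R) :
  is_norm N -> exists2 C, 0 < C & forall A, N A <= C * l1norm A.
Proof.
move=> hN; have [ND NZ _] := hN.
exists (1 + \sum_i \sum_j N (delta_mx i j)).
  rewrite ltr_pwDl // sumr_ge0 // => i _; rewrite sumr_ge0 // => j _.
  exact: is_norm_ge0.
move=> A; rewrite [X in N X]matrix_sum_delta.
apply: le_trans (is_norm_sum _ _ hN) _.
rewrite mulrDl mul1r; apply: ler_wpDl; first exact: l1norm_ge0.
rewrite mulr_suml; apply: ler_sum => i _.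
apply: le_trans (is_norm_sum _ _ hN) _; rewrite mulr_suml.
apply: ler_sum => j _; rewrite NZ mulrC ler_wpM2l ?is_norm_ge0 //.
exact: entry_le_l1norm.
Qed.

Lemma entry_le_supnorm (R : realType) n (x : 'rV[R]_n) j : `|x 0 j| <= `|x|.
Proof.
have -> : `|x| = mx_norm x by [].
rewrite mx_normrE.
exact: (le_bigmax _ (fun ij : 'I_1 * 'I_n => `|x ij.1 ij.2|) (0, j)).
Qed.

Lemma sum_ord_le (R : realType) n (F : 'I_n -> R) c :
  (forall i, F i <= c) -> \sum_i F i <= c *+ n.
Proof.
by move=> h; rewrite -[in leRHS](card_ord n) -sumr_const; exact: ler_sum.
Qed.

Lemma l1norm_le_supnorm (R : realType) n (x : 'rV[R]_n) :
  l1norm x <= n%:R * `|x|.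
Proof.
rewrite /l1norm big_ord1 mulr_natl.
by apply: sum_ord_le => j; exact: entry_le_supnorm.
Qed.

(** By [norm_le_l1norm] the norm [N] is Lipschitz, so it attains its minimum on
    the compact unit sphere of the sup norm; this minimum is positive. *)
Lemma supnorm_le_norm (R : realType) n (N : 'rV[R]_n -> R) :
  is_norm N -> exists2 C, 0 < C & forall x, `|x| <= C * N x.
Proof.
move=> hN; have [ND NZ N0] := hN.
have [C C0 NC] := norm_le_l1norm hN.
have NB x y : N x - N y <= N (x - y).
  by have := ND (x - y) y; rewrite subrK; lra.
have NN x y : N (x - y) = N (y - x).
  by rewrite -[x - y]opprB -scaleN1r NZ normrN1 mul1r.
have lip x y : `|N x - N y| <= C * n%:R * `|x - y|.
  rewrite -mulrA (le_trans _ (ler_wpM2l (ltW C0) (l1norm_le_supnorm _))) //.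
  apply: le_trans (NC _).
  by rewrite ler_norml NB andbT; have := NB y x; rewrite NN; lra.
have Ncont : continuous N.
  move=> x; apply/(@cvgrPdist_le _ _ _ _ (nbhs_filter x)) => e e0.
  have K0 : 0 < C * n%:R + 1 by rewrite ltr_wpDl ?mulr_ge0 ?ler0n // ltW.
  near=> y; apply: le_trans (lip _ _) _.
  have xy : `|x - y| <= e / (C * n%:R + 1).
    near: y; apply: (@cvgr_dist_le _ _ _ (nbhs x) (nbhs_filter x) id x cvg_id).
    by rewrite divr_gt0.
  move: xy; rewrite ler_pdivlMr // mulrDr mulr1.
  have := normr_ge0 (x - y); lra.
pose S : set 'rV[R]_n := [set x | `|x| = 1].
(* the sphere is empty in dimension 0 *)
have [S0|/set0P Sn0] := eqVneq S set0.
  exists 1 => // x; rewrite mul1r.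
  have [->|x0] := eqVneq x 0; first by rewrite normr0 is_norm_ge0.
  suff : S (`|x|^-1 *: x) by rewrite S0.
  by rewrite /S /= normrZ normrV ?unitfE ?normr_eq0 // normr_id mulVf ?normr_eq0.
have Scpt : compact S.
  apply: bounded_closed_compact.
    by exists 1; split=> // M /ltW ? x /= ->.
  have -> : S = Num.Def.normr @^-1` [set x : R | x = 1] by [].
  apply: preimage_closed; last exact: closed_eq.
  by move=> x _; exact: norm_continuous.
have [c] := EVT_min_rV Sn0 Scpt (continuous_subspaceT Ncont).
rewrite inE => Sc cmin.
have c0 : 0 < N c.
  rewrite lt_def is_norm_ge0 // andbT; apply/eqP => /N0 cE.
  by move: Sc; rewrite /S /= cE normr0; apply/eqP; rewrite eq_sym oner_eq0.
exists (N c)^-1; first by rewrite invr_gt0.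
move=> x; rewrite mulrC ler_pdivlMr //.
have [->|x0] := eqVneq x 0; first by rewrite normr0 mul0r is_norm_ge0.
have x0' : 0 < `|x| by rewrite normr_gt0.
have : N c <= N (`|x|^-1 *: x).
  apply: cmin; rewrite inE /S /= normrZ normrV ?unitfE ?normr_eq0 // normr_id.
  by rewrite mulVf ?normr_eq0.
by rewrite NZ gtr0_norm ?invr_gt0 // mulrC ler_pdivlMr // mulrC.
Unshelve. all: by end_near. Qed.

Lemma l1norm_le_norm (R : realType) m n (N : 'M[R]_(m, n) -> R) :
  is_norm N -> exists2 C, 0 < C & forall A, l1norm A <= C * N A.
Proof.
move=> hN; have [ND NZ N0] := hN.
have hNv : is_norm (fun x : 'rV[R]_(m * n) => N (vec_mx x)).
  split=> [x y|a x|x /N0 /eqP]; first by rewrite linearD ND.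
    by rewrite linearZ NZ.
  by rewrite vec_mx_eq0 => /eqP.
have [C C0 hC] := supnorm_le_norm hNv.
exists ((m * n)%:R * C + 1).
  by rewrite ltr_wpDl // mulr_ge0 ?ler0n // ltW.
move=> A; rewrite mulrDl mul1r ler_wpDr ?is_norm_ge0 //.
have := hC (mxvec A); rewrite mxvecK => {}hC.
rewrite -mulrA (le_trans _ (ler_wpM2l (ler0n _ _) hC)) //.
rewrite natrM -mulrA mulr_natl; apply: sum_ord_le => i.
rewrite mulr_natl; apply: sum_ord_le => j.
by rewrite -mxvecE; exact: entry_le_supnorm.
Qed.

(** * The joint spectral radius as an infimum of growth rates *)

Definition growth_rate (R : realType) m n (A : 'I_m -> 'M[R]_n) : set R :=
  [set r | 0 < r /\
    exists C, forall s, l1norm (word_prod A s) <= C * r ^+ size s].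

Lemma growth_rate_has_lbound (R : realType) m n (A : 'I_m -> 'M[R]_n) :
  has_lbound (growth_rate A).
Proof. by exists 0 => r [/ltW]. Qed.

Lemma l1norm_word_le (R : realType) m n (A : 'I_m -> 'M[R]_n) s :
  l1norm (word_prod A s) <=
  l1norm (1%:M : 'M[R]_n) * (1 + \sum_i l1norm (A i)) ^+ size s.
Proof.
set b := 1 + _.
have b0 : 0 <= b.
  by rewrite addr_ge0 // sumr_ge0 // => i _; exact: l1norm_ge0.
elim: s => [|i s IH]; first by rewrite word_prod_nil expr0 mulr1.
rewrite word_prod_cons /= exprSr mulrA.
apply: le_trans (l1norm_mulmx _ _) _.
apply: ler_pM IH _; rewrite ?l1norm_ge0 // /b (bigD1 i) //=.
rewrite addrCA lerDl addr_ge0 // sumr_ge0 // => j _; exact: l1norm_ge0.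
Qed.

Lemma growth_rate_nonempty (R : realType) m n (A : 'I_m -> 'M[R]_n) :
  growth_rate A !=set0.
Proof.
exists (1 + \sum_i l1norm (A i)); split.
  by rewrite ltr_wpDr // sumr_ge0 // => i _; exact: l1norm_ge0.
by exists (l1norm (1%:M : 'M[R]_n)) => s; exact: l1norm_word_le.
Qed.

(** The submultiplicative half of Fekete's lemma: a word is a concatenation of
    blocks of length [k], each contributing at most [r ^ k], and of a remainder
    shorter than [k], which is absorbed by the constant. *)
Lemma growth_rate_of_block (R : realType) m n (A : 'I_m -> 'M[R]_n) k r :
  (0 < k)%N -> 0 < r ->
  (forall s, size s = k -> l1norm (word_prod A s) <= r ^+ k) ->
  growth_rate A r.
Proof.
move=> k0 r0 hk; split=> //.
set b := 1 + \sum_i l1norm (A i).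
have b0 : 0 <= b.
  by rewrite addr_ge0 // sumr_ge0 // => i _; exact: l1norm_ge0.
(* [q ^+ k] bounds [(b / r) ^+ t] for all [t < k], whichever of [b] and [r] is
   the larger *)
pose q := 1 + b / r.
have br0 : 0 <= b / r by rewrite divr_ge0 // ltW.
exists (l1norm (1%:M : 'M[R]_n) * q ^+ k).
move=> s; have [p] := ubnP (size s).
elim: p s => // p IH s sp; case: (ltnP (size s) k) => sk.
  apply: le_trans (l1norm_word_le _ _) _.
  rewrite -mulrA ler_wpM2l ?l1norm_ge0 //.
  have -> : b ^+ size s = (b / r) ^+ size s * r ^+ size s.
    by rewrite -exprMn divfK // gt_eqF.
  rewrite ler_wpM2r ?exprn_ge0 ?(ltW r0) //.
  apply: (@le_trans _ _ (q ^+ size s)).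
    by rewrite lerXn2r ?nnegrE ?addr_ge0 // lerDr.
  by rewrite ler_weXn2l ?lerDl // ltnW.
rewrite -{1}(cat_take_drop k s) word_prod_cat.
apply: le_trans (l1norm_mulmx _ _) _.
rewrite -[X in r ^+ X](subnK sk) exprD mulrA.
apply: ler_pM; rewrite ?l1norm_ge0 //.
  rewrite -size_drop; apply: IH; rewrite size_drop.
  move: sp; rewrite ltnS; apply: leq_trans.
  by rewrite ltn_subrL k0 (leq_trans k0 sk).
by apply: hk; rewrite size_takel.
Qed.

Lemma cvg_powR_inv (R : realType) (c : R) :
  0 < c -> c `^ k%:R^-1 @[k --> \oo] --> (1 : R).
Proof.
move=> c0; rewrite -(cvg_shiftS (fun k => c `^ k%:R^-1)) /=.
have -> : (fun k => c `^ k.+1%:R^-1) = (fun k => expR (k.+1%:R^-1 * ln c)).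
  by apply/funext => k; rewrite /powR gt_eqF.
suff : expR (k.+1%:R^-1 * ln c) @[k --> \oo] --> expR 0 by rewrite expR0.
apply: continuous_cvg.
  exact: continuous_expR.
rewrite -[0](mul0r (ln c)); apply: cvgMl; exact: cvg_harmonic.
Qed.

Lemma max_growth_ge0 (R : realType) m n (N : 'M[R]_n -> R)
    (A : 'I_m -> 'M[R]_n) k : 0 <= max_growth N A k.
Proof. exact: bigmax_ge_id. Qed.

Lemma max_growth_le (R : realType) m n (N : 'M[R]_n -> R)
    (A : 'I_m -> 'M[R]_n) r : is_norm N -> growth_rate A r ->
  exists2 c, 0 < c & forall k, max_growth N A k.+1 <= c `^ k.+1%:R^-1 * r.
Proof.
move=> hN [r0 [C hC]]; have [C' C'0 hC'] := norm_le_l1norm hN.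
exists (C' * `|C| + 1); first by rewrite ltr_wpDl // mulr_ge0 // ltW.
move=> k; have c0 : 0 <= C' * `|C| + 1 by rewrite addr_ge0 // mulr_ge0 // ltW.
apply: bigmax_le => [|s _]; first by rewrite mulr_ge0 ?powR_ge0 // ltW.
have -> : (C' * `|C| + 1) `^ k.+1%:R^-1 * r =
    ((C' * `|C| + 1) * r ^+ k.+1) `^ k.+1%:R^-1.
  rewrite powRM ?exprn_ge0 ?(ltW r0) // -powR_mulrn ?(ltW r0) //.
  by rewrite -powRrM mulfV ?pnatr_eq0 // powRr1 // ltW.
apply: ge0_ler_powR.
- by rewrite invr_ge0 ler0n.
- by rewrite nnegrE is_norm_ge0.
- by rewrite nnegrE mulr_ge0 // exprn_ge0 // ltW.
apply: le_trans (hC' _) _.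
have := hC s; rewrite size_tuple => {}hC.
have rk : 0 <= r ^+ k.+1 by rewrite exprn_ge0 // ltW.
apply: le_trans (ler_wpM2l (ltW C'0) hC) _.
rewrite mulrA ler_wpM2r //.
apply: (@le_trans _ _ (C' * `|C|)); last by rewrite lerDl.
by rewrite ler_wpM2l ?(ltW C'0) // ler_norm.
Qed.

(** The maximal growth over words of one fixed length is, up to the constant
    relating the norms, already a growth rate, by [growth_rate_of_block]. *)
Lemma max_growth_ge (R : realType) m n (N : 'M[R]_n -> R)
    (A : 'I_m -> 'M[R]_n) : is_norm N ->
  exists2 c, 0 < c & forall k,
    c `^ k.+1%:R^-1 * inf (growth_rate A) <= max_growth N A k.+1.
Proof.
move=> hN; have [C C0 hC] := l1norm_le_norm hN.
exists C^-1 => [|k]; first by rewrite invr_gt0.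
set g := max_growth N A k.+1; set p := k.+1%:R^-1.
have g0 : 0 <= g := max_growth_ge0 N A _.
have Cp : 0 < C `^ p by exact: powR_gt0.
have -> : C^-1 `^ p = (C `^ p)^-1.
  by rewrite -(powR_inv1 (ltW C0)) powRAC (powR_inv1 (ltW Cp)).
rewrite mulrC ler_pdivrMr // mulrC.
apply/ler_addgt0Pr => e e0; apply: ge_inf; first exact: growth_rate_has_lbound.
have r0 : 0 < C `^ p * g + e by rewrite ltr_wpDl // mulr_ge0 // ltW.
apply: (@growth_rate_of_block _ _ _ _ k.+1) => // s sk.
apply: le_trans (hC _) _.
apply: (@le_trans _ _ ((C `^ p * g) ^+ k.+1)); last first.
  by rewrite lerXn2r ?nnegrE ?mulr_ge0 ?(ltW r0) ?(ltW Cp) // lerDl ltW.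
have pow x : 0 <= x -> (x `^ p) ^+ k.+1 = x.
  move=> x0; rewrite -powR_mulrn ?powR_ge0 // -powRrM mulVf ?pnatr_eq0 //.
  exact: powRr1.
rewrite exprMn pow ?(ltW C0) // ler_wpM2l ?(ltW C0) //.
rewrite -[leLHS]pow; last exact: is_norm_ge0.
rewrite lerXn2r ?nnegrE ?powR_ge0 //.
have ssz : size s == k.+1 by apply/eqP.
exact: (le_bigmax _ (fun t : k.+1.-tuple 'I_m => N (word_prod A t) `^ p)
  (Tuple ssz)).
Qed.

(** This includes the convergence of the sequence that defines [jsr], which is
    squeezed between the two preceding bounds. *)
Lemma jsrE (R : realType) m n (N : 'M[R]_n -> R) (A : 'I_m -> 'M[R]_n) :
  is_norm N -> jsr N A = inf (growth_rate A).
Proof.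
move=> hN; apply/cvg_lim => //.
set rho := inf _.
have [c c0 hc] := max_growth_ge A hN.
apply/cvgrPdist_le => e e0.
have [||r hr re] := @inf_adherent _ (growth_rate A) (e / 2).
- by rewrite divr_gt0.
- by split; [exact: growth_rate_nonempty|exact: growth_rate_has_lbound].
have [d d0 hd] := max_growth_le hN hr.
have lo : c `^ k%:R^-1 * rho @[k --> \oo] --> rho.
  by rewrite -[X in _ --> X]mul1r; apply: cvgMl; exact: cvg_powR_inv.
have up : d `^ k%:R^-1 * r @[k --> \oo] --> r.
  by rewrite -[X in _ --> X]mul1r; apply: cvgMl; exact: cvg_powR_inv.
near=> k.
have k0 : (0 < k)%N by near: k; exists 1%N.
have lk : `|rho - c `^ k%:R^-1 * rho| <= e.
  by near: k; apply: cvgr_dist_le.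
have uk : `|r - d `^ k%:R^-1 * r| <= e / 2.
  by near: k; apply: cvgr_dist_le => //; rewrite divr_gt0.
have := hc k.-1; have := hd k.-1; rewrite !prednK // -/rho.
move: lk uk re; rewrite !ler_norml -/rho; move: (max_growth N A k) => g.
lra.
Unshelve. all: by end_near. Qed.

(** * Quadratic forms *)

Definition bform (R : realType) n (P : 'M[R]_n) (x y : 'cV[R]_n) : R :=
  (x^T *m P *m y) 0 0.

Lemma bformBl (R : realType) n (P : 'M[R]_n) x y z :
  bform P (x - y) z = bform P x z - bform P y z.
Proof. by rewrite /bform linearB /= !mulmxBl [LHS]mxE [X in _ + X]mxE. Qed.

Lemma bformBr (R : realType) n (P : 'M[R]_n) x y z :
  bform P z (x - y) = bform P z x - bform P z y.
Proof. by rewrite /bform mulmxBr [LHS]mxE [X in _ + X]mxE. Qed.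

Lemma bformZl (R : realType) n (P : 'M[R]_n) a x y :
  bform P (a *: x) y = a * bform P x y.
Proof. by rewrite /bform linearZ /= -!scalemxAl [LHS]mxE. Qed.

Lemma bformZr (R : realType) n (P : 'M[R]_n) a x y :
  bform P x (a *: y) = a * bform P x y.
Proof. by rewrite /bform -scalemxAr [LHS]mxE. Qed.

Lemma bformC (R : realType) n (P : 'M[R]_n) x y :
  P^T = P -> bform P x y = bform P y x.
Proof.
move=> PT; rewrite /bform -[in LHS](trmxK (x^T *m P *m y)) mxE.
by rewrite !trmx_mul trmxK PT mulmxA.
Qed.

Definition sqnorm (R : realType) n (x : 'cV[R]_n) : R := (x^T *m x) 0 0.

Lemma sqnormE (R : realType) n (x : 'cV[R]_n) : sqnorm x = \sum_i x i 0 ^+ 2.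
Proof. by rewrite /sqnorm mxE; apply: eq_bigr => i _; rewrite mxE. Qed.

Lemma sqnorm_ge0 (R : realType) n (x : 'cV[R]_n) : 0 <= sqnorm x.
Proof. by rewrite sqnormE sumr_ge0 // => i _; exact: sqr_ge0. Qed.

Lemma sqnorm_eq0 (R : realType) n (x : 'cV[R]_n) : sqnorm x = 0 -> x = 0.
Proof.
rewrite sqnormE => /eqP; rewrite psumr_eq0 => [/allP h|i _]; last exact: sqr_ge0.
apply/colP => i; rewrite mxE; apply/eqP; rewrite -sqrf_eq0.
by apply: h; rewrite mem_index_enum.
Qed.

Lemma posdef_ge0 (R : realType) n (P : 'M[R]_n) x :
  posdef P -> 0 <= bform P x x.
Proof.
move=> [_ Ppos]; have [->|/Ppos/ltW//] := eqVneq x 0.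
by rewrite /bform mulmx0 mxE.
Qed.

(** Positivity at the vector [bform P y y *: x - bform P x y *: y], the component
    of [x] orthogonal to [y] up to a factor. *)
Lemma posdef_cauchy_schwarz (R : realType) n (P : 'M[R]_n) (x y : 'cV[R]_n) :
  posdef P -> bform P x y ^+ 2 <= bform P x x * bform P y y.
Proof.
move=> hP; have [PT Ppos] := hP.
have [->|y0] := eqVneq y 0.
  by rewrite /bform !mulmx0 !mxE mulr0 expr0n.
have q0 : 0 < bform P y y := Ppos y y0.
have := posdef_ge0 (bform P y y *: x - bform P x y *: y) hP.
rewrite !(bformBl, bformBr, bformZl, bformZr) (bformC y x) //.
set b := bform P x y; set q := bform P y y in q0 *; set p := bform P x x.
have -> : q * (q * p - b * b) - b * (q * b - b * q) =
  q * (p * q - b ^+ 2) by ring.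
by rewrite pmulr_rge0 // subr_ge0.
Qed.

Lemma posdef_unitmx (R : realType) n (P : 'M[R]_n) : posdef P -> P \in unitmx.
Proof.
move=> [PT Ppos]; rewrite unitmxE unitfE; apply/det0P => -[v v0 vP].
by have := Ppos v^T; rewrite trmxK vP mul0mx mxE ltxx trmx_eq0 => /(_ v0).
Qed.

Lemma sqnorm_cauchy_schwarz (R : realType) n (x y : 'cV[R]_n) :
  (x^T *m y) 0 0 ^+ 2 <= sqnorm x * sqnorm y.
Proof.
have h : posdef (1%:M : 'M[R]_n).
  split=> [|z z0]; first exact: trmx1.
  rewrite mulmx1 lt_def sqnorm_ge0 andbT.
  by apply: contra_neq z0 => /sqnorm_eq0.
by have := posdef_cauchy_schwarz x y h; rewrite /bform !mulmx1.
Qed.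

(** * Rescaling an ellipsoid along one axis *)

(** The two factorizations [L *m U = U' *m L'] of one block matrix have these two
    determinants. *)
Lemma det_rank1_update (R : realType) n (v : 'cV[R]_n) (w : 'rV[R]_n) :
  \det (1%:M + v *m w) = 1 + (w *m v) 0 0.
Proof.
pose L : 'M[R]_(1 + n) := block_mx 1%:M 0 v 1%:M.
pose U : 'M[R]_(1 + n) := block_mx 1%:M (- w) 0 (1%:M + v *m w).
pose U' : 'M[R]_(1 + n) := block_mx 1%:M (- w) 0 1%:M.
pose L' : 'M[R]_(1 + n) := block_mx (1%:M + w *m v) 0 v 1%:M.
have E : L *m U = U' *m L'.
  rewrite !mulmx_block !(mul1mx, mulmx1, mul0mx, mulmx0, addr0, add0r).
  by rewrite mulmxN mulNmx addrK addrCA addNr addr0.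
have := congr1 determinant E.
rewrite !det_mulmx !det_lblock !det_ublock !det1 !(mul1r, mulr1) => ->.
by rewrite det_mx11 !mxE eqxx.
Qed.

(** The matrix multiplies [y] by [a] and the orthogonal complement of [y] by
    [b]. *)
Lemma det_axis_scaling (R : realType) n (y : 'cV[R]_n) (a b : R) :
  (0 < n)%N -> b != 0 -> (y^T *m y) 0 0 != 0 ->
  \det (b%:M + ((a - b) / (y^T *m y) 0 0) *: (y *m y^T)) = b ^+ n.-1 * a.
Proof.
move=> n0 b0 t0; set t := (y^T *m y) 0 0 in t0 *.
have -> : b%:M + ((a - b) / t) *: (y *m y^T) =
    b *: (1%:M + (((a - b) / t / b) *: y) *m y^T).
  by rewrite scalerDr scalemx1 -scalemxAl scalerA [b * (_ / b)]mulrC divfK.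
rewrite detZ det_rank1_update -scalemxAr mxE -/t -{1}(prednK n0) exprSr.
by field; rewrite b0 t0.
Qed.

Lemma bernoulli_ineq (R : realType) (d : R) k :
  0 <= d <= 1 -> 1 - k%:R * d <= (1 - d) ^+ k.
Proof.
move=> d01; elim: k => [|k IH]; first by rewrite mul0r subr0 expr0.
rewrite exprS; apply: (@le_trans _ _ ((1 - d) * (1 - k%:R * d))).
  by rewrite -natr1; have := ler0n R k; nra.
by rewrite ler_wpM2l //; lra.
Qed.

(** Squared scaling factors [1 - d] on a hyperplane and [1 - d + d * K] on its
    normal increase the squared volume for small [d] when [K] exceeds the
    dimension: to first order in [d], the gain is [d * (K - n)]. *)
Lemma axis_scaling_gain (R : realType) n (K : R) : (0 < n)%N -> n%:R < K ->
  exists d : R, [/\ 0 < d, d < 1 & 1 < (1 - d) ^+ n.-1 * (1 - d + d * K)].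
Proof.
move=> n0 nK.
have n1 : 1 <= n%:R :> R by rewrite ler1n.
have K0 : 0 < K by lra.
have nK0 : 0 < n%:R * K by rewrite mulr_gt0 //; lra.
pose d := (K - n%:R) / (n%:R * K).
have dE : d * (n%:R * K) = K - n%:R by rewrite divfK // gt_eqF.
have d0 : 0 < d by rewrite divr_gt0 //; lra.
have d1 : d < 1 by rewrite ltr_pdivrMr //; nra.
exists d; split=> //; clearbody d.
have c0 : 0 < 1 - d + d * K by nra.
apply: (@lt_le_trans _ _ ((1 - n.-1%:R * d) * (1 - d + d * K))); last first.
  by rewrite ler_pM2r //; apply: bernoulli_ineq; lra.
have -> : n.-1%:R = n%:R - 1 :> R by rewrite -[in RHS](prednK n0) -natr1; lra.
have -> : (1 - (n%:R - 1) * d) * (1 - d + d * K) =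
   1 + d * ((K - n%:R) - d * (n%:R * K) + d * (K + n%:R - 1)) by ring.
rewrite dE subrr add0r ltrDl.
by apply: mulr_gt0 => //; apply: mulr_gt0 => //; lra.
Qed.

Lemma sqnorm_axis_scaling (R : realType) n (g y : 'cV[R]_n) (a b : R) :
  sqnorm y != 0 ->
  sqnorm ((b%:M + ((a - b) / sqnorm y) *: (y *m y^T)) *m g) =
  b ^+ 2 * sqnorm g + (a ^+ 2 - b ^+ 2) * ((y^T *m g) 0 0 ^+ 2 / sqnorm y).
Proof.
move=> t0; set t := sqnorm y in t0 *; set p := (y^T *m g) 0 0.
have -> : (b%:M + ((a - b) / t) *: (y *m y^T)) *m g =
    b *: g + ((a - b) / t * p) *: y.
  rewrite mulmxDl mul_scalar_mx -scalemxAl -mulmxA [y^T *m g]mx11_scalar.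
  by rewrite mul_mx_scalar scalerA.
set c := _ * p.
have -> : sqnorm (b *: g + c *: y) =
    b ^+ 2 * sqnorm g + b * c * p *+ 2 + c ^+ 2 * t.
  rewrite /t /p /sqnorm !mxE !mulr_sumr -!sumrMnl -!big_split /=.
  by apply: eq_bigr => i _; rewrite !mxE; ring.
by rewrite /c; field.
Qed.

(** * An approximate Loewner ellipsoid *)

(** [{f | sqnorm (T *m f) <= 1}] is an ellipsoid of nearly minimal volume
    containing [S].  If [y] violated the last clause, the points of [T S]
    would lie in the slab [sqnorm y > K * (y^T g) ^ 2]; composing [T] with a
    map that stretches along [y] and shrinks the orthogonal complement of [y]
    would then keep [S] inside and multiply [(\det T) ^+ 2] by the factor of
    [axis_scaling_gain].  Because [K] is larger than [n] this factor is fixed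
    and exceeds 1, so near-optimality of [T] is enough. *)
Lemma loewner_ellipsoid (R : realType) n (S : set 'cV[R]_n) (c K : R) :
  (0 < n)%N -> n%:R < K ->
  (forall j, S (delta_mx j 0)) -> (forall f, S f -> sqnorm f <= c) ->
  exists T : 'M[R]_n, [/\ T \in unitmx,
    forall f, S f -> sqnorm (T *m f) <= 1
  & forall (y : 'cV[R]_n) h,
    (forall f, S f -> (y^T *m (T *m f)) 0 0 ^+ 2 <= h) ->
    sqnorm y <= K * h].
Proof.
move=> n0 nK Sdelta Sc.
have K0 : 0 < K by rewrite (le_lt_trans _ nK).
pose feas (T : 'M[R]_n) := forall f, S f -> sqnorm (T *m f) <= 1.
pose E := [set (\det T) ^+ 2 | T in feas].
have c0 : 0 <= c.
  by apply: le_trans (Sc _ (Sdelta (Ordinal n0))); exact: sqnorm_ge0.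
pose z := (1 + c)^-1.
have z0 : 0 < z by rewrite invr_gt0 ltr_wpDr.
have z1 : z * (1 + c) = 1 by rewrite mulVf // gt_eqF // ltr_wpDr.
(* a small homothety is admissible, so the supremum is positive *)
have Ez : E ((z ^+ n) ^+ 2).
  exists z%:M; last by rewrite det_scalar.
  move=> f Sf; rewrite mul_scalar_mx.
  have -> : sqnorm (z *: f) = z ^+ 2 * sqnorm f.
    rewrite /sqnorm [(z *: f)^T]linearZ /= -scalemxAl -scalemxAr scalerA.
    by rewrite [LHS]mxE.
  have := Sc f Sf; have := sqnorm_ge0 f; nra.
(* the columns of an admissible [T] are images of basis vectors, so its
   determinant is bounded *)
have entry T : feas T -> forall i j, `|T i j| <= 1.
  move=> hT i j; have := hT _ (Sdelta j); rewrite sqnormE (bigD1 i) //=.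
  rewrite -colE mxE => hij.
  have : T i j ^+ 2 <= 1.
    apply: le_trans hij; rewrite lerDl sumr_ge0 // => *; exact: sqr_ge0.
  by rewrite -real_normK ?num_real // expr_le1.
have Eub : has_ubound E.
  exists ((\sum_(s : 'S_n) 1) ^+ 2) => _ [T /entry hT <-].
  have dT : `|\det T| <= \sum_(s : 'S_n) 1.
    rewrite /determinant; apply: le_trans (ler_norm_sum _ _ _) _.
    apply: ler_sum => s _; rewrite normrM normrX normrN1 expr1n mul1r.
    rewrite normr_prod; apply: prodr_ile1 => i _.
    by rewrite normr_ge0 hT.
  rewrite -real_normK ?num_real // lerXn2r ?nnegrE //.
  by rewrite sumr_ge0.
have [d [d0 d1 gain]] := axis_scaling_gain n0 nK.
set k := _ * _ in gain.
have Esup : has_sup E by split=> //; exists ((z ^+ n) ^+ 2).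
have s0 : 0 < sup E.
  by apply: lt_le_trans (ub_le_sup Eub Ez); rewrite !exprn_gt0.
have k0 : 0 < k by rewrite (lt_trans _ gain).
(* [T] misses the supremum by a factor less than the gain [k] *)
have eps0 : 0 < sup E - sup E / k by rewrite subr_gt0 ltr_pdivrMr // ltr_pMr.
have [_ [T hT <-]] := sup_adherent eps0 Esup.
rewrite subKr ltr_pdivrMr // => Tk.
exists T; split=> //.
  rewrite unitmxE unitfE; apply: contraTneq Tk => ->.
  by rewrite expr0n mul0r -leNgt ltW.
move=> y h hy; rewrite leNgt; apply/negP => Kh.
have h0 : 0 <= h.
  by apply: le_trans (hy _ (Sdelta (Ordinal n0))); exact: sqr_ge0.
set t := sqnorm y in Kh.
have t0 : 0 < t by rewrite (le_lt_trans _ Kh) // mulr_ge0 // ltW.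
pose b := Num.sqrt (1 - d); pose a := Num.sqrt (1 - d + d * K).
have b2 : b ^+ 2 = 1 - d by rewrite sqr_sqrtr // subr_ge0 ltW.
have a2 : a ^+ 2 = 1 - d + d * K.
  by rewrite sqr_sqrtr // addr_ge0 ?mulr_ge0 ?subr_ge0 // ltW.
have b0 : b != 0 by rewrite sqrtr_eq0 -ltNge subr_gt0.
pose G := b%:M + ((a - b) / t) *: (y *m y^T).
have GT : feas (G *m T).
  move=> f Sf; rewrite -mulmxA sqnorm_axis_scaling ?gt_eqF // a2 b2.
  have -> : 1 - d + d * K - (1 - d) = d * K by ring.
  have fT := hT f Sf; have fh := hy f Sf.
  have : K * ((y^T *m (T *m f)) 0 0 ^+ 2 / t) <= 1.
    rewrite mulrA ler_pdivrMr // mul1r (le_trans _ (ltW Kh)) //.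
    by rewrite ler_wpM2l // ltW.
  rewrite -/t; move: (_ / t) => u Ku; have := sqnorm_ge0 (T *m f); nra.
have : E (\det (G *m T) ^+ 2) by exists (G *m T).
move/(ub_le_sup Eub); rewrite det_mulmx /G det_axis_scaling // ?gt_eqF //.
have -> : (b ^+ n.-1 * a * \det T) ^+ 2 = (\det T) ^+ 2 * k.
  rewrite !exprMn a2 exprAC b2 /k; ring.
by rewrite leNgt Tk.
Qed.

(** * Common quadratic form from an invariant set of functionals *)

(** [bform Q x x] lies between [h x] and [K * h x], where [h x] is the supremum of
    [(x^T f) ^ 2] over [f] in [S], and [h (B x) <= r ^ 2 * h x].  The form is
    chosen before [B], so that it may be used for products of matrices. *)
Lemma common_quadratic (R : realType) n (S : set 'cV[R]_n) (c K : R) :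
  (0 < n)%N -> n%:R < K ->
  (forall j, S (delta_mx j 0)) -> (forall f, S f -> sqnorm f <= c) ->
  exists2 Q : 'M[R]_n, posdef Q &
    forall (B : 'M[R]_n) (r : R),
      (forall f, S f -> exists2 g, S g & B^T *m f = r *: g) ->
      forall x, bform Q (B *m x) (B *m x) <= K * r ^+ 2 * bform Q x x.
Proof.
move=> n0 nK Sdelta Sc.
have [T [Tu ST TS]] := loewner_ellipsoid n0 nK Sdelta Sc.
pose V := invmx T^T; pose Q := V^T *m V.
have QE x : bform Q x x = sqnorm (V *m x).
  by rewrite /bform /sqnorm /Q trmx_mul !mulmxA.
have TV x : T^T *m (V *m x) = x.
  by rewrite mulmxA mulmxV ?unitmx_tr // mul1mx.
exists Q.
  split=> [|x x0]; first by rewrite /Q trmx_mul trmxK.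
  rewrite -/(bform Q x x) QE lt_def sqnorm_ge0 andbT.
  by apply: contra_neq x0 => /sqnorm_eq0 Vx; rewrite -(TV _ x) Vx mulmx0.
move=> B r hB x; rewrite !QE -mulrA; apply: TS => f /hB [g Sg Bf].
have -> : (V *m (B *m x))^T *m (T *m f) = r *: ((V *m x)^T *m (T *m g)).
  have adj u h : (V *m u)^T *m (T *m h) = u^T *m h.
    by rewrite -[T]trmxK mulmxA -trmx_mul TV.
  by rewrite !adj trmx_mul -mulmxA Bf -scalemxAr.
rewrite mxE exprMn ler_wpM2l ?sqr_ge0 //.
apply: le_trans (sqnorm_cauchy_schwarz _ _) _.
by rewrite ler_piMr ?sqnorm_ge0 // ST.
Qed.

(** * Feasible values and growth rates *)

Lemma growth_rate_of_feasible (R : realType) m n (A : 'I_m -> 'M[R]_n) g :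
  (0 < m)%N -> 0 < g -> lmi_feasible A g -> growth_rate A g^-1.
Proof.
move=> m0 g0 [P [Ppos Pfeas]]; split; first by rewrite invr_gt0.
have step i j x : g ^+ 2 * bform (P j) (A i *m x) (A i *m x) <= bform (P i) x x.
  have [_ /(_ x)] := Pfeas i j.
  rewrite mulmxBr mulmxBl mxE [X in _ + X]mxE subr_ge0.
  by rewrite -scalemxAr -scalemxAl mxE /bform trmx_mul !mulmxA.
(* the node [i] at which the estimate starts is the first letter of the word *)
have decay s : forall j, exists i, forall x,
    (g ^+ size s) ^+ 2 * bform (P j) (word_prod A s *m x) (word_prod A s *m x)
    <= bform (P i) x x.
  elim: s => [j|a s IH j].
    by exists j => x; rewrite word_prod_nil mul1mx expr0 expr1n mul1r.
  have [i hi] := IH j; exists a => x.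
  rewrite word_prod_cons -mulmxA /= (exprS g) exprMn -mulrA.
  by apply: le_trans (step a i x); rewrite ler_wpM2l ?sqr_ge0.
pose j0 : 'I_m := Ordinal m0; pose P0 := P j0.
have P0u : P0 \in unitmx by exact: posdef_unitmx (Ppos j0).
pose e (i : 'I_n) : 'cV[R]_n := delta_mx i 0.
pose D := \sum_i \sum_l `|bform (P i) (e l) (e l)|.
pose F := \sum_l `|bform P0 (invmx P0 *m e l) (invmx P0 *m e l)|.
have Ple i l : bform (P i) (e l) (e l) <= D.
  rewrite (le_trans (ler_norm _)) // /D (bigD1 i) //= (bigD1 l) //=.
  by rewrite -addrA lerDl addr_ge0 ?sumr_ge0 // => j _; rewrite sumr_ge0.
have Fle l : bform P0 (invmx P0 *m e l) (invmx P0 *m e l) <= F.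
  by rewrite (le_trans (ler_norm _)) // /F (bigD1 l) //= lerDl sumr_ge0.
exists ((Num.sqrt (F * D)) *+ n *+ n) => s.
have entry k l : `|word_prod A s k l| <= Num.sqrt (F * D) * g^-1 ^+ size s.
  set W := word_prod A s.
  (* the coordinate [k] is the functional represented by [invmx P0 *m e k] for
     the scalar product [P0], to which Cauchy-Schwarz applies *)
  have -> : W k l = bform P0 (invmx P0 *m e k) (W *m e l).
    have [P0T _] := Ppos j0.
    rewrite /bform trmx_mul trmx_inv P0T -(mulmxA (e k)^T) mulVmx // mulmx1.
    by rewrite -colE /e trmx_delta -rowE !mxE.
  have [i hi] := decay s j0.
  have := posdef_cauchy_schwarz (invmx P0 *m e k) (W *m e l) (Ppos j0).
  rewrite -/P0; set b := bform P0 _ (W *m e l) => hb.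
  rewrite exprVn ler_pdivlMr ?exprn_gt0 // -[X in _ * X]ger0_norm; last first.
    by rewrite exprn_ge0 // ltW.
  rewrite -normrM -sqrtr_sqr ler_wsqrtr // exprMn.
  have gs : 0 <= (g ^+ size s) ^+ 2 by exact: sqr_ge0.
  apply: le_trans (ler_wpM2r gs hb) _; rewrite -mulrA.
  have hW := posdef_ge0 (W *m e l) (Ppos j0).
  apply: ler_pM (Fle k) _; first exact: posdef_ge0 (Ppos j0).
    by rewrite mulr_ge0.
  by rewrite mulrC (le_trans (hi _)).
rewrite /l1norm !mulrnAl; apply: sum_ord_le => k.
by apply: sum_ord_le => l.
Qed.

(** The condition [n r ^ 4 < l ^ 4] leaves room for the constant
    [K = l ^ 4 / r ^ 4 > n] of [common_quadratic]. *)
Lemma feasible_of_growth_rate (R : realType) m n (A : 'I_m -> 'M[R]_n) r l :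
  (0 < n)%N -> growth_rate A r -> 0 < l -> n%:R * r ^+ 4 < l ^+ 4 ->
  lmi_feasible A l^-1.
Proof.
move=> n0 [r0 [C hC]] l0 rl.
pose S := [set f : 'cV[R]_n |
  exists s j, f = r ^- size s *: (word_prod A s)^T *m delta_mx j 0].
have Sdelta j : S (delta_mx j 0).
  by exists [::], j; rewrite word_prod_nil trmx1 expr0 invr1 scale1r mul1mx.
have Sc f : S f -> sqnorm f <= C ^+ 2 *+ n.
  move=> [s [j ->]]; rewrite sqnormE; apply: sum_ord_le => i.
  rewrite -scalemxAl mxE -colE !mxE exprMn -real_normK ?num_real //.
  rewrite -[X in _ * X]real_normK ?num_real // -exprMn.
  rewrite ger0_norm ?invr_ge0 ?exprn_ge0 ?(ltW r0) //.
  rewrite lerXn2r ?nnegrE ?mulr_ge0 ?invr_ge0 ?exprn_ge0 ?(ltW r0) //.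
  + have := hC [::]; rewrite expr0 mulr1; apply: le_trans; exact: l1norm_ge0.
  + rewrite mulrC ler_pdivrMr ?exprn_gt0 // (le_trans _ (hC _)) //.
    exact: entry_le_l1norm.
have step i f : S f -> exists2 g, S g & (A i)^T *m f = r *: g.
  move=> [s [j ->]].
  exists (r ^- size (i :: s) *: (word_prod A (i :: s))^T *m delta_mx j 0).
    by exists (i :: s), j.
  rewrite word_prod_cons trmx_mul -!scalemxAl -scalemxAr scalerA mulmxA /=.
  by rewrite exprS invfM mulrA divff ?mul1r // gt_eqF.
pose K := l ^+ 4 / r ^+ 4.
have nK : n%:R < K by rewrite ltr_pdivlMr ?exprn_gt0.
have [Q Qpos hQ] := common_quadratic n0 nK Sdelta Sc.
have two i j x : bform Q (A j *m (A i *m x)) (A j *m (A i *m x)) <=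
    l ^+ 4 * bform Q x x.
  have -> : l ^+ 4 = K * (r * r) ^+ 2.
    by rewrite /K -expr2 -exprM divfK // expf_neq0 // gt_eqF.
  rewrite mulmxA; apply: hQ => f /step - /(_ j) [g Sg fg].
  have [h Sh gh] := step i _ Sg; exists h => //.
  by rewrite trmx_mul -mulmxA fg -scalemxAr gh scalerA.
have [QT _] := Qpos.
(* the term [l ^- 2 *: ...] telescopes along an edge [i -> j], leaving [two] *)
pose P i := Q + l ^- 2 *: ((A i)^T *m Q *m A i).
have PE i x : bform (P i) x x =
    bform Q x x + l ^- 2 * bform Q (A i *m x) (A i *m x).
  rewrite /bform /P mulmxDr mulmxDl mxE -scalemxAr -scalemxAl [X in _ + X]mxE.
  by rewrite trmx_mul !mulmxA.
have PT i : (P i)^T = P i.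
  by rewrite /P linearD linearZ /= !trmx_mul trmxK QT mulmxA.
exists P; split=> [i|i j].
  split=> // x x0; rewrite -/(bform _ x x) PE ltr_wpDr //.
    by rewrite mulr_ge0 ?posdef_ge0 // invr_ge0 exprn_ge0 // ltW.
  by have [_ ->] := Qpos.
split; first by rewrite linearB linearZ /= !trmx_mul trmxK !PT mulmxA.
move=> x; rewrite mulmxBr mulmxBl mxE [X in _ + X]mxE subr_ge0.
rewrite -scalemxAr -scalemxAl mxE.
have -> : (x^T *m ((A i)^T *m P j *m A i) *m x) 0 0 =
  bform (P j) (A i *m x) (A i *m x) by rewrite /bform trmx_mul !mulmxA.
rewrite -/(bform _ x x) !PE exprVn mulrDr [leRHS]addrC lerD2l.
have -> : l ^- 2 * (l ^- 2 * bform Q (A j *m (A i *m x)) (A j *m (A i *m x))) =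
  bform Q (A j *m (A i *m x)) (A j *m (A i *m x)) / l ^+ 4.
  by field; rewrite gt_eqF.
by rewrite ler_pdivrMr ?exprn_gt0 // mulrC two.
Qed.

(** * Comparison of the bound with the joint spectral radius *)

Theorem theorem5p4 (R : realType) (m n : nat) (hm : (0 < m)%N) (hn : (0 < n)%N)
    (N : 'M[R]_n -> R) (hN : is_norm N) (A : 'I_m -> 'M[R]_n) :
  (n%:R `^ 4^-1)^-1 * rho_hat A <= jsr N A <= rho_hat A.
Proof.
rewrite jsrE //; set q := n%:R `^ 4^-1.
have q0 : 0 < q by rewrite powR_gt0 // ltr0n.
have q4 : q ^+ 4 = n%:R.
  rewrite -powR_mulrn ?powR_ge0 // -powRrM mulVf ?pnatr_eq0 //.
  by rewrite powRr1 // ler0n.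
have feas r l : growth_rate A r -> q * r < l ->
    [set gamma^-1 | gamma in [set g : R | 0 < g /\ lmi_feasible A g]] l.
  move=> hr ql; have [r0 _] := hr.
  have l0 : 0 < l by apply: lt_trans ql; rewrite mulr_gt0.
  exists l^-1; last by rewrite invrK.
  split; first by rewrite invr_gt0.
  apply: feasible_of_growth_rate hr _ _ => //.
  by rewrite -q4 -exprMn ltrXn2r // ltW // mulr_gt0.
apply/andP; split; last first.
  apply: lb_le_inf.
    have [r hr] := growth_rate_nonempty A.
    by exists (q * r + 1); apply: feas hr _; rewrite ltrDl.
  move=> _ [g [g0 hg] <-]; apply: ge_inf; first exact: growth_rate_has_lbound.
  exact: growth_rate_of_feasible.
apply: lb_le_inf; first exact: growth_rate_nonempty.
move=> r hr; rewrite mulrC ler_pdivrMr // mulrC.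
apply/ler_addgt0Pr => e e0; apply: ge_inf.
  by exists 0 => _ [g [g0 _] <-]; rewrite invr_ge0 ltW.
by apply: feas hr _; rewrite ltrDl.
Qed.
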